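(* Let $\sigma$ and $\tau$ be two signed permutation matrices which are NE-shape Wilf equivalent. Put $$\sigma'=\begin{pmatrix}0&\sigma\\ \sigma^t&0\end{pmatrix},\qquad \tau'=\begin{pmatrix}0&\tau\\ \tau^t&0\end{pmatrix},$$ where $^t$ denotes the transpose. Then $\sigma'$ and $\tau'$ are I-Wilf equivalent, i.e. $|SI_n(\sigma')|=|SI_n(\tau')|$ for every $n\ge 1$. Moreover, for every $n\ge1$ there is a bijection $SI_n(\sigma')\to SI_n(\tau')$ which preserves fixed points.
   Context: A signed permutation matrix of size $n$ is an $n\times n$ matrix with entries in $\{0,1,-1\}$ having exactly one nonzero entry in every row and every column; $B_n$ denotes the set of these. $SI_n$ is the set of involutions in $B_n$, i.e. the symmetric signed permutation matrices of size $n$. A matrix $p\in B_n$ corresponds to the word $\pi=\pi_1\cdots\pi_n$ with $\pi_i=j$ if $p_{ij}=1$ and $\pi_i=-j$ if $p_{ij}=-1$; the two are identified. An index $i$ is a fixed point of a signed involution $\pi$ if $|\pi_i|=i$. An element $\pi\in B_n$ contains $\tau\in B_k$ if the matrix $\tau$ is a submatrix of the matrix $\pi$ (rows and columns kept in order); otherwise $\pi$ avoids $\tau$. For a set $M$ of signed permutations, $M(\tau)$ is the set of elements of $M$ avoiding $\tau$. A Young shape (Young diagram) is a top-justified and left-justified array of cells whose rows have non-increasing lengths from top to bottom (so its columns have non-increasing lengths from left to right). An NE-shape is a top-right justified array of cells, i.e. the mirror image of a Young shape under left-right reflection. A signed transversal of a shape $\lambda$ is an assignment of $0$'s, $1$'s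 and $-1$'s to the cells of $\lambda$ such that each row and each column contains exactly one nonzero entry. A filling of $\lambda$ contains a $k\times k$ signed permutation matrix $\tau$ if there are $k$ rows and $k$ columns of $\lambda$ such that all $k^2$ cells in their intersection belong to $\lambda$ and the induced filling of these cells equals $\tau$; otherwise it avoids $\tau$. $B_\lambda(\tau)$ is the set of signed transversals of $\lambda$ avoiding $\tau$. Two signed permutation matrices $\sigma,\tau$ are NE-shape Wilf equivalent if $|B_\lambda(\sigma)|=|B_\lambda(\tau)|$ for every NE-shape $\lambda$. *)

(* Defs.v *)
From HB Require Import structures.
From mathcomp Require Import all_boot all_order all_algebra.
From mathcomp Require Import boolp classical_sets functions cardinality.

Set Implicit Arguments.
Unset Strict Implicit.
Unset Printing Implicit Defensive.

Import Order.TTheory GRing.Theory Num.Theory.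
Local Open Scope classical_set_scope.
Local Open Scope card_scope.
Local Open Scope ring_scope.

Definition one_nonzero_per_line m n (p : 'M[int]_(m, n)) : Prop :=
  [/\ forall i j, p i j \in [:: 0; 1; -1],
      forall i, exists! j, p i j != 0
    & forall j, exists! i, p i j != 0].

Definition signed_perm n : set 'M[int]_n := [set p | one_nonzero_per_line p].

Definition signed_invol n : set 'M[int]_n :=
  [set p | signed_perm p /\ p *m p = 1%:M].

(* Indices are 0-based in ['I_n], hence the successors.  For a signed           *)
(* permutation only one term of the sum is nonzero; see [wordE].                *)
Definition word n (p : 'M[int]_n) (i : 'I_n) : int :=
  \sum_(j < n) p i j * j.+1%:Z.

Definition fixed_point n (p : 'M[int]_n) (i : 'I_n) : Prop :=
  `|word p i| = i.+1%:Z.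

Definition increasing k n (f : 'I_k -> 'I_n) : Prop :=
  {homo f : a b / (a < b)%N}.

Definition contains n k (p : 'M[int]_n) (t : 'M[int]_k) : Prop :=
  exists f g : 'I_k -> 'I_n,
    [/\ increasing f, increasing g & mxsub f g p = t].

Definition signed_invol_avoiding n k (t : 'M[int]_k) : set 'M[int]_n :=
  [set p | signed_invol p /\ ~ contains p t].

(* A shape with at most [m] rows and [n] columns is given by its cells;         *)
(* [r i] is the length of row [i].  Rows of length 0 and columns of length 0    *)
(* are allowed, but a shape that has one admits no transversal.                 *)
Definition Young_shape m n (D : 'I_m -> 'I_n -> bool) : Prop :=
  exists2 r : 'I_m -> nat,
    (forall i i' : 'I_m, (i <= i')%N -> (r i' <= r i)%N)
    & forall i j, D i j = (j < r i)%N.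

Definition NE_shape m n (D : 'I_m -> 'I_n -> bool) : Prop :=
  Young_shape (fun i j => D i (rev_ord j)).

(* A filling of the shape [D] is represented by its extension by 0 to the       *)
(* whole [m] by [n] rectangle.                                                  *)
Definition signed_transversal m n (D : 'I_m -> 'I_n -> bool) :
    set 'M[int]_(m, n) :=
  [set p | one_nonzero_per_line p /\ forall i j, ~~ D i j -> p i j = 0].

Definition shape_contains m n k (D : 'I_m -> 'I_n -> bool)
    (p : 'M[int]_(m, n)) (t : 'M[int]_k) : Prop :=
  exists (f : 'I_k -> 'I_m) (g : 'I_k -> 'I_n),
    [/\ increasing f, increasing g, forall a b, D (f a) (g b)
      & mxsub f g p = t].

Definition transversal_avoiding m n k (D : 'I_m -> 'I_n -> bool)
    (t : 'M[int]_k) : set 'M[int]_(m, n) :=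
  [set p | signed_transversal D p /\ ~ shape_contains D p t].

(* All the sets compared with [#=] below are finite.                            *)
Definition NE_shape_Wilf_equiv k l (s : 'M[int]_k) (t : 'M[int]_l) : Prop :=
  forall m n (D : 'I_m -> 'I_n -> bool), NE_shape D ->
    transversal_avoiding D s #= transversal_avoiding D t.

Definition I_Wilf_equiv k l (s : 'M[int]_k) (t : 'M[int]_l) : Prop :=
  forall n, (0 < n)%N ->
    signed_invol_avoiding (n := n) s #= signed_invol_avoiding (n := n) t.

Definition double_mx k (s : 'M[int]_k) : 'M[int]_(k + k) :=
  block_mx 0 s s^T 0.

Lemma wordE n (p : 'M[int]_n) (i j : 'I_n) :
  signed_perm p -> p i j != 0 -> word p i = p i j * j.+1%:Z.
Proof.
move=> [_ rowp _] pij; rewrite /word (bigD1 j) //= big1 ?addr0 // => j' nj.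
have [j0 [_ uj0]] := rowp i.
case: (eqVneq (p i j') 0) => [->|pij']; first by rewrite mul0r.
by move: nj; rewrite -(uj0 _ pij) -(uj0 _ pij') eqxx.
Qed.

Lemma signed_perm_mulmx_tr n (p : 'M[int]_n) :
  signed_perm p -> p *m p^T = 1%:M.
Proof.
move=> [entp rowp colp]; apply/matrixP => i i'; rewrite !mxE.
have [j [pij uj]] := rowp i.
rewrite (bigD1 j) //= big1 ?addr0 ?mxE => [|j' nj]; last first.
  case: (eqVneq (p i j') 0) => [->|/uj ej]; first by rewrite mul0r.
  by rewrite ej eqxx in nj.
have [<-|nii] := eqVneq i i'.
  by move: (entp i j) pij; rewrite !inE => /or3P[] /eqP ->.
case: (eqVneq (p i' j) 0) => [->|pi'j]; first by rewrite mulr0.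
have [i0 [_ ui0]] := colp j.
by move: nii; rewrite -(ui0 _ pij) -(ui0 _ pi'j) eqxx.
Qed.

Lemma signed_involE n :
  @signed_invol n = [set p | signed_perm p /\ p^T = p].
Proof.
apply/seteqP; split=> p [sp e]; split=> //; have ppT := signed_perm_mulmx_tr sp.
  by rewrite -[p^T]mul1mx -e -mulmxA ppT mulmx1.
by rewrite -{2}e.
Qed.

(* Main.v *)
Require Import Defs.
From mathcomp Require Import all_boot all_order all_algebra.
From mathcomp Require Import boolp classical_sets functions cardinality.

(** A signed involution [p] is a symmetric signed permutation matrix, hence it
    is determined by its diagonal and by the entries strictly above it.  Read
    [p] as a partial matching of the indices: the nonzero entries above the
    diagonal are signed arcs [(i, j)], [i < j], with opener [i] and closer [j],
    and the other indices are the fixed points.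

    An occurrence of the doubled pattern of [s] has two symmetric halves, one of
    which is an occurrence of [s] all of whose cells lie above the diagonal;
    conversely such an occurrence and its mirror image form the doubled pattern
    ([contains_double]).  As each row and column of [s] has a nonzero entry,
    the rows used are openers and the columns used are closers of [p].

    Fix the diagonal, the set [O] of openers and the set [C] of closers (the
    [shadow] of [p]).  The cells [(i, j)] of [O] x [C] with [i < j] form an
    NE-shape ([arc_shape_NE]) that depends on the shadow only, and restricting
    [p] to [O] x [C] is a bijection from the signed involutions with this shadow
    onto the signed transversals of that shape ([corner_inj],
    [assemble_invol]).  It turns avoidance of the doubled pattern into avoidance
    of [s] in the shape ([corner_bij]).  NE-shape Wilf equivalence therefore
    gives a bijection for each shadow; together they form a bijection that
    preserves shadows ([glue_bij]), and in particular the fixed points, which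
    are the nonzero diagonal entries. *)

Set Implicit Arguments.
Unset Strict Implicit.
Unset Printing Implicit Defensive.

Import Order.TTheory GRing.Theory Num.Theory.
Local Open Scope card_scope.
Local Open Scope ring_scope.

(** * Enumerating a set of indices in increasing order *)

Lemma enum_val_homo n (A : {set 'I_n}) (a b : 'I_#|A|) :
  (a < b)%N -> (enum_val a < enum_val b)%N.
Proof.
move=> ab; pose lt (i j : 'I_n) := (i < j)%N.
have lt_sorted : sorted lt (enum A).
  rewrite /enum_mem; apply: sorted_filter; first by move=> x y z; apply: ltn_trans.
  rewrite -enumT (_ : lt = relpre val ltn) // -sorted_map val_enum_ord.
  exact: iota_ltn_sorted.
have x0 := enum_val a; rewrite !(enum_val_nth x0).
have lt_trans : transitive lt by move=> x y z; apply: ltn_trans.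
by apply: (sorted_ltn_nth lt_trans) => //; rewrite inE -cardE.
Qed.

Lemma enum_val_mono n (A : {set 'I_n}) (a b : 'I_#|A|) :
  (enum_val a < enum_val b)%N = (a < b)%N.
Proof.
apply/idP/idP; last exact: enum_val_homo.
case: (ltngtP a b) => // [/enum_val_homo/ltnW|/val_inj->].
  by rewrite leqNgt => /negbTE->.
by rewrite ltnn.
Qed.

Lemma enum_val_onto (T : finType) (A : {set T}) (x : T) :
  x \in A -> exists a : 'I_#|A|, x = enum_val a.
Proof. by move=> xA; exists (enum_rank_in xA x); rewrite enum_rankK_in. Qed.

(** * Signed involutions as partial matchings *)

Section Matching.

Variable n : nat.
Implicit Types (p q : 'M[int]_n) (i j : 'I_n) (A B : {set 'I_n}).

Lemma signed_invol_sym p i j : signed_invol p -> p i j = p j i.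
Proof. by rewrite signed_involE => -[_ e]; rewrite -{1}e mxE. Qed.

Lemma signed_invol_row_inj p i j j' :
  signed_invol p -> p i j != 0 -> p i j' != 0 -> j = j'.
Proof.
case=> -[_ row_p _] _ pij pij'; have [j0 [_ u]] := row_p i.
by rewrite -(u j) // -(u j').
Qed.

(** For symmetric matrices the conditions on columns follow from those on
    rows. *)
Lemma sym_signed_invol p :
  (forall i j, p i j \in [:: 0; 1; -1]) -> (forall i j, p i j = p j i) ->
  (forall i, exists! j, p i j != 0) -> signed_invol p.
Proof.
move=> ent sym row_p; rewrite signed_involE.
split; last by apply/matrixP => i j; rewrite mxE.
split=> // j; have [i [pji u]] := row_p j; exists i; split; first by rewrite sym.
by move=> i'; rewrite sym => /u.
Qed.

Definition openers p := finset (fun i => [exists j : 'I_n, (i < j)%N && (p i j != 0)]).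

Definition closers p := finset (fun i => [exists j : 'I_n, (j < i)%N && (p i j != 0)]).

Lemma openersP p i :
  reflect (exists2 j : 'I_n, (i < j)%N & p i j != 0) (i \in openers p).
Proof.
by rewrite inE; apply: (iffP existsP) => [[j /andP[]]|[j ? ?]]; exists j => //; apply/andP.
Qed.

Lemma closersP p i :
  reflect (exists2 j : 'I_n, (j < i)%N & p i j != 0) (i \in closers p).
Proof.
by rewrite inE; apply: (iffP existsP) => [[j /andP[]]|[j ? ?]]; exists j => //; apply/andP.
Qed.

Lemma arc_opener p i j : (i < j)%N -> p i j != 0 -> i \in openers p.
Proof. by move=> ij pij; apply/openersP; exists j. Qed.

Lemma arc_closer p i j :
  signed_invol p -> (i < j)%N -> p i j != 0 -> j \in closers p.
Proof.
by move=> hp ij; rewrite signed_invol_sym // => pji; apply/closersP; exists i.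
Qed.

(** The nonzero entry of a row is unique, so one arc to the right of [i]
    determines on which side of [i] its whole row lives. *)
Lemma opener_partner p i j :
  signed_invol p -> i \in openers p -> p i j != 0 -> (i < j)%N.
Proof.
by move=> hp /openersP[j' ij' pij'] pij; rewrite (signed_invol_row_inj hp pij pij').
Qed.

Lemma closer_partner p i j :
  signed_invol p -> i \in closers p -> p i j != 0 -> (j < i)%N.
Proof.
by move=> hp /closersP[j' ij' pij'] pij; rewrite (signed_invol_row_inj hp pij pij').
Qed.

(** The partner of [i], the column of the nonzero entry of its row, is equal to
    [i], larger, or smaller. *)
Lemma invol_trichotomy p i : signed_invol p ->
  [\/ [/\ p i i != 0, i \notin openers p & i \notin closers p],
      [/\ p i i = 0, i \in openers p & i \notin closers p] |
      [/\ p i i = 0, i \notin openers p & i \in closers p]].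
Proof.
move=> hp; have [[_ row_p _] _] := hp; have [j [pij _]] := row_p i.
have disj : i \in openers p -> i \notin closers p.
  move=> iO; apply/negP => /closer_partner-/(_ j hp pij).
  by apply/negP; rewrite -leqNgt ltnW // (opener_partner hp iO pij).
have diag0 : i != j -> p i i = 0.
  by apply: contra_neq_eq => pii; apply: (signed_invol_row_inj hp pii pij).
case: (ltngtP i j) => [ij|ji|/val_inj eij].
- have iO := arc_opener ij pij; apply: Or32; split=> //; last exact: disj.
  by apply: diag0; rewrite neq_ltn ij.
- have iC : i \in closers p by apply/closersP; exists j.
  apply: Or33; split=> //; last by apply: contraL iC.
  by apply: diag0; rewrite neq_ltn ji orbT.
- rewrite -eij in pij; apply: Or31; split=> //.
    by apply/negP => /opener_partner-/(_ i hp pij); rewrite ltnn.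
  by apply/negP => /closer_partner-/(_ i hp pij); rewrite ltnn.
Qed.

(** The part of the data of [p] that the bijection keeps: it fixes the shape
    above the diagonal and contains the fixed points with their signs. *)
Definition shadow p := (\row_i p i i, openers p, closers p).

Lemma shadow_diag p q i : shadow p = shadow q -> p i i = q i i.
Proof. by move=> [+ _ _] => /rowP/(_ i); rewrite !mxE. Qed.

Lemma fixed_point_diag p i : signed_invol p -> fixed_point p i <-> p i i != 0.
Proof.
move=> hp; have [sp _] := hp; have [ent row_p _] := sp; have [j [pij _]] := row_p i.
have normp : `|p i j| = 1.
  by move: (ent i j) pij; rewrite !inE => /or3P[] /eqP ->; rewrite ?eqxx.
rewrite /fixed_point (wordE sp pij) normrM normp mul1r; split=> [[]|pii].
  by move/val_inj => eji; rewrite -{2}eji.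
by rewrite (signed_invol_row_inj hp pij pii).
Qed.

(** * The transversal above the diagonal *)

Definition arc_shape A B (a : 'I_#|A|) (b : 'I_#|B|) : bool :=
  (enum_val a < enum_val b)%N.

Definition corner A B p : 'M[int]_(#|A|, #|B|) := mxsub enum_val enum_val p.

Lemma cornerE A B p a b : corner A B p a b = p (enum_val a) (enum_val b).
Proof. by rewrite mxE. Qed.

(** Moving up or to the right preserves [i < j]. *)
Lemma arc_shape_NE A B : NE_shape (@arc_shape A B).
Proof.
(* The reflected row is an initial segment, so its length is one more than its
   largest index. *)
pose D' (a : 'I_#|A|) (b : 'I_#|B|) := arc_shape a (rev_ord b).
exists (fun a => \max_(b | D' a b) b.+1)%N => [a a'|a b].
  rewrite leq_eqVlt => /orP[/eqP/val_inj->//|/enum_val_homo aa'].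
  apply/bigmax_leqP => b a'b; apply: (@leq_bigmax_cond _ _ (fun b : 'I_#|B| => b.+1)).
  exact: ltn_trans aa' a'b.
apply/idP/idP => [ab|].
  exact: (@leq_bigmax_cond _ (D' a) (fun b : 'I_#|B| => b.+1)).
apply: contraTT => nab; rewrite -leqNgt; apply/bigmax_leqP => b' ab'.
rewrite ltnNge; apply: contra nab => bb'; apply: leq_trans ab' _.
move: bb'; rewrite leq_eqVlt => /orP[/eqP/val_inj->//|bb'].
by apply/ltnW/enum_val_homo/ltn_sub2l; first exact: leq_ltn_trans bb' (ltn_ord b').
Qed.

(** Each opener has its arc end at a closer, and conversely, so the openers and
    closers are exactly the rows and columns occupied above the diagonal. *)
Lemma corner_transversal p : signed_invol p ->
  signed_transversal (@arc_shape (openers p) (closers p))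
    (corner (openers p) (closers p) p).
Proof.
move=> hp; have [[ent row_p _] _] := hp.
split; last first.
  move=> a b; rewrite cornerE; apply: contraNeq.
  exact: opener_partner (enum_valP a).
split=> [a b|a|b]; first by rewrite cornerE.
  have /openersP[j ij pij] := enum_valP a.
  have [b ej] := enum_val_onto (arc_closer hp ij pij).
  exists b; split=> [|b']; rewrite cornerE -?ej // => pij'.
  by apply: enum_val_inj; rewrite -ej (signed_invol_row_inj hp pij pij').
have /closersP[i ij pji] := enum_valP b.
have pij : p i (enum_val b) != 0 by rewrite signed_invol_sym.
have [a ei] := enum_val_onto (arc_opener ij pij).
exists a; split=> [|a']; rewrite cornerE -?ei // signed_invol_sym // => pji'.
by apply: enum_val_inj; rewrite -ei (signed_invol_row_inj hp pji pji').
Qed.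

(** A nonzero entry of [p] or of [q] above the diagonal sits in an opener row and
    a closer column, where the corners compare the two matrices. *)
Lemma corner_inj p q : signed_invol p -> signed_invol q -> shadow p = shadow q ->
  corner (openers p) (closers p) p = corner (openers p) (closers p) q -> p = q.
Proof.
move=> hp hq epq ec; have [_ eO eC] := epq.
have above i j : (i < j)%N -> p i j = q i j.
  move=> ij; have agree : i \in openers p -> j \in closers p -> p i j = q i j.
    move=> /enum_val_onto[a ->] /enum_val_onto[b ->].
    by move/matrixP: ec => /(_ a b); rewrite !cornerE.
  have [p0|pij] := eqVneq (p i j) 0; last first.
    by apply: agree; [apply: arc_opener pij | apply: arc_closer pij].
  have [q0|qij] := eqVneq (q i j) 0; first by rewrite p0.
  by apply: agree; rewrite ?eO ?eC; [apply: arc_opener qij | apply: arc_closer qij].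
apply/matrixP => i j; case: (ltngtP i j) => [/above//|/above|/val_inj->].
  by rewrite signed_invol_sym // => ->; rewrite signed_invol_sym.
exact: shadow_diag.
Qed.

Definition embed A B (t : 'M[int]_(#|A|, #|B|)) : 'M[int]_n :=
  \matrix_(i, j)
    if ([pick a | enum_val a == i], [pick b | enum_val b == j]) is (Some a, Some b)
    then t a b else 0.

Lemma embedE A B (t : 'M[int]_(#|A|, #|B|)) a b :
  embed t (enum_val a) (enum_val b) = t a b.
Proof.
rewrite mxE; case: pickP => [a' /eqP/enum_val_inj->|/(_ a)]; last by rewrite eqxx.
by case: pickP => [b' /eqP/enum_val_inj->|/(_ b)]; last by rewrite eqxx.
Qed.

Lemma embed_supp A B (t : 'M[int]_(#|A|, #|B|)) i j : embed t i j != 0 ->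
  exists a b, [/\ i = enum_val a, j = enum_val b & t a b != 0].
Proof.
rewrite mxE; case: pickP => [a /eqP<-|]; last by rewrite eqxx.
by case: pickP => [b /eqP<- tab|]; [exists a, b | rewrite eqxx].
Qed.

(** The inverse of [corner]: the diagonal of [p], with [t] spread out above it and
    its mirror image below. *)
Definition assemble p A B (t : 'M[int]_(#|A|, #|B|)) : 'M[int]_n :=
  \matrix_(i, j) if i == j then p i i
                 else if (i < j)%N then embed t i j else embed t j i.

Section Assemble.

Variable p : 'M[int]_n.
Hypothesis hp : signed_invol p.
Local Notation O := (openers p).
Local Notation C := (closers p).
Variable t : 'M[int]_(#|O|, #|C|).
Hypothesis ht : signed_transversal (@arc_shape O C) t.
Local Notation q := (assemble p t).

Lemma assemble_diag i : q i i = p i i.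
Proof. by rewrite mxE eqxx. Qed.

Lemma assemble_above i j : (i < j)%N -> q i j = embed t i j.
Proof. by move=> ij; rewrite mxE -val_eqE /= ltn_eqF // ij. Qed.

Lemma assemble_sym i j : q i j = q j i.
Proof.
have [->//|nij] := eqVneq i j; rewrite !mxE (eq_sym j) (negbTE nij).
by case: ltngtP => // /val_inj eij; rewrite eij eqxx in nij.
Qed.

Lemma transversal_arc a b : t a b != 0 -> (enum_val a < enum_val b)%N.
Proof. by case: ht => _ zero; apply: contraR => /zero->. Qed.

(** [t] vanishes outside the shape, so no entry of [t] is lost by keeping only the
    cells above the diagonal; that the mirror image does not interfere in
    [O] x [C] is due to [O] and [C] being disjoint. *)
Lemma assemble_arc a b : q (enum_val a) (enum_val b) = t a b.
Proof.
have [ab|nab] := boolP (enum_val a < enum_val b)%N.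
  by rewrite assemble_above // embedE.
have t0 : t a b = 0 by case: ht => _; apply.
rewrite t0; apply/eqP; apply: contraT => qab.
have bO : enum_val b \notin O.
  have := enum_valP b; case: (invol_trichotomy (enum_val b) hp) => -[_ // _ /negP + ?].
  by case.
have neq : enum_val b != enum_val a.
  by apply: contraNneq bO => ->; apply: enum_valP.
move: qab; rewrite assemble_sym assemble_above => [/embed_supp[a' [_ [eb _ _]]]|].
  by rewrite eb enum_valP in bO.
by rewrite ltn_neqAle neq leqNgt.
Qed.

(** The row of an opener comes from a row of [t], that of a closer from a column of
    [t], and that of any other index from the diagonal of [p]. *)
Lemma assemble_invol : signed_invol q.
Proof.
have [[ent_t row_t col_t] zero] := ht.
have [[ent_p _ _] _] := hp.
apply: sym_signed_invol => [i j||i].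
- rewrite mxE; case: ifP => // _.
  have ent x y : embed t x y \in [:: 0; 1; -1].
    by have [->//|/embed_supp[a [b [-> -> _]]]] := eqVneq (embed t x y) 0; rewrite embedE.
  by case: ifP.
- exact: assemble_sym.
have arc_ends (x y : 'I_n) : (x < y)%N -> q x y != 0 ->
    exists a b, [/\ x = enum_val a, y = enum_val b & t a b != 0].
  by move=> xy; rewrite assemble_above // => /embed_supp.
have ends (x y : 'I_n) : q x y != 0 -> [\/ x = y, x \in O /\ (x < y)%N | x \in C /\ (y < x)%N].
  case: (ltngtP x y) => [xy|yx|/val_inj]; last by constructor.
    by move=> /(arc_ends _ _ xy)[a [b [-> _ _]]]; apply: Or32; rewrite enum_valP.
  rewrite assemble_sym => /(arc_ends _ _ yx)[a [b [_ -> _]]].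
  by apply: Or33; rewrite enum_valP.
case: (invol_trichotomy i hp) => -[pii iO iC].
- exists i; split=> [|j /ends[]//]; first by rewrite assemble_diag.
    by case=> iO'; rewrite iO' in iO.
  by case=> iC'; rewrite iC' in iC.
- have [a ei] := enum_val_onto iO; have [b [tab u]] := row_t a.
  exists (enum_val b); split=> [|j]; first by rewrite ei assemble_arc.
  move=> qij; case: (ends _ _ qij) => [eij|[_ ij]|[iC' _]].
  + by move: qij; rewrite -eij assemble_diag pii eqxx.
  + have [a' [b' [ei' ej tab']]] := arc_ends _ _ ij qij.
    have eaa : a' = a by apply: enum_val_inj; rewrite -ei -ei'.
    by rewrite ej (u b') // -eaa.
  + by rewrite iC' in iC.
- have [b ei] := enum_val_onto iC; have [a [tab u]] := col_t b.
  exists (enum_val a); split=> [|j]; first by rewrite assemble_sym ei assemble_arc.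
  move=> qij; case: (ends _ _ qij) => [eij|[iO' _]|[_ ji]].
  + by move: qij; rewrite -eij assemble_diag pii eqxx.
  + by rewrite iO' in iO.
  + rewrite assemble_sym in qij.
    have [a' [b' [ej ei' tab']]] := arc_ends _ _ ji qij.
    have ebb : b' = b by apply: enum_val_inj; rewrite -ei -ei'.
    by rewrite ej (u a') // -ebb.
Qed.

Lemma corner_assemble : corner O C q = t.
Proof. by apply/matrixP => a b; rewrite cornerE assemble_arc. Qed.

(** All openers and closers of [p] remain so by construction; as the fixed points
    are also the same, the trichotomy leaves no room for further ones. *)
Lemma shadow_assemble : shadow q = shadow p.
Proof.
have hq := assemble_invol; have [[_ row_t col_t] zero] := ht.
have subO i : i \in O -> i \in openers q.
  move=> /enum_val_onto[a ->]; have [b [tab _]] := row_t a.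
  by apply: (arc_opener (transversal_arc tab)); rewrite assemble_arc.
have subC i : i \in C -> i \in closers q.
  move=> /enum_val_onto[b ->]; have [a [tab _]] := col_t b.
  by apply: (arc_closer hq (transversal_arc tab)); rewrite assemble_arc.
rewrite /shadow; congr (_, _, _).
- by apply/rowP => i; rewrite !mxE eqxx.
- apply/setP => i; apply/idP/idP => [iq|/subO//].
  case: (invol_trichotomy i hp) (invol_trichotomy i hq) => -[pii iO iC] //.
    by case=> -[]; rewrite ?iq // assemble_diag => pi0; rewrite pi0 eqxx in pii.
  by case=> -[]; rewrite ?iq ?subC.
- apply/setP => i; apply/idP/idP => [iq|/subC//].
  case: (invol_trichotomy i hp) (invol_trichotomy i hq) => -[pii iO iC] //.
    by case=> -[]; rewrite ?iq // assemble_diag => pi0; rewrite pi0 eqxx in pii.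
  by case=> -[]; rewrite ?iq ?subO.
Qed.

End Assemble.

(** * Occurrences of the doubled pattern *)

Definition contains_above k p (s : 'M[int]_k) : Prop :=
  exists f g : 'I_k -> 'I_n,
    [/\ increasing f, increasing g, forall a b, (f a < g b)%N & mxsub f g p = s].

(** If the upper right block of the occurrence does not lie above the diagonal,
    then some chosen column of that block is weakly left of some chosen row, and
    this forces the transpose of the lower left block to lie above the diagonal.
    Conversely, the rows and the columns of an occurrence above the diagonal,
    put one after the other, index both the rows and the columns of an occurrence
    of the doubled pattern: its diagonal blocks vanish because the nonzero entry
    of each of these lines is already in the pattern. *)
Lemma contains_double k p (s : 'M[int]_k) : signed_invol p -> signed_perm s ->
  contains p (double_mx s) <-> contains_above p s.
Proof.
move=> hp [_ row_s col_s]; split=> [[F [G [incF incG /matrixP e]]]|[f [g [incf incg fg e]]]].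
  have ur a b : p (F (lshift k a)) (G (rshift k b)) = s a b.
    by have := e (lshift k a) (rshift k b); rewrite block_mxEur mxE.
  have dl a b : p (F (rshift k b)) (G (lshift k a)) = s a b.
    by have := e (rshift k b) (lshift k a); rewrite block_mxEdl !mxE.
  have lt_lr (a b : 'I_k) : (lshift k a < rshift k b)%N by rewrite /= ltn_addr.
  have incl (H : 'I_(k + k) -> 'I_n) : increasing H -> increasing (H \o lshift k).
    by move=> incH a b ab; apply: incH.
  have incr (H : 'I_(k + k) -> 'I_n) : increasing H -> increasing (H \o @rshift k k).
    by move=> incH a b ab; apply: incH; rewrite /= ltn_add2l.
  have [/forallP lt_FG|] := boolP [forall a : 'I_k, forall b : 'I_k, F (lshift k a) < G (rshift k b)]%N.
    exists (F \o lshift k), (G \o @rshift k k); split; [exact: incl|exact: incr| |].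
      by move=> a b; apply/forallP: b; apply: lt_FG.
    by apply/matrixP => a b; rewrite mxE ur.
  rewrite negb_forall => /existsP[a]; rewrite negb_forall => /existsP[b].
  rewrite -leqNgt => le_GF.
  exists (G \o lshift k), (F \o @rshift k k); split; [exact: incl|exact: incr| |].
    move=> a' b' /=; apply: leq_trans (incG _ _ (lt_lr a' b)) _.
    by apply: leq_trans le_GF _; apply/ltnW/incF.
  by apply/matrixP => a' b'; rewrite mxE signed_invol_sym //= dl.
have es a b : p (f a) (g b) = s a b by rewrite -e mxE.
pose F x := match fintype.split x with inl a => f a | inr b => g b end.
have Fl a : F (lshift k a) = f a.
  by rewrite /F -[lshift k a]/(unsplit (inl a)) unsplitK.
have Fr a : F (rshift k a) = g a.
  by rewrite /F -[rshift k a]/(unsplit (inr a)) unsplitK.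
have incF : increasing F.
  move=> x y; rewrite -(splitK x) -(splitK y).
  case: (fintype.split x) (fintype.split y) => [a|a] [b|b] /=; rewrite ?Fl ?Fr //.
  - exact: incf.
  - by rewrite ltnNge ltnW // ltn_addr.
  - by rewrite ltn_add2l; apply: incg.
exists F, F; split=> //; apply/matrixP => x y; rewrite mxE.
rewrite -(splitK x) -(splitK y); case: (fintype.split x) (fintype.split y) => [a|a] [b|b] /=.
- rewrite block_mxEul mxE !Fl; have [c [sc _]] := row_s a.
  apply: contraTeq (fg b c) => pab; rewrite -leqNgt.
  by rewrite (@signed_invol_row_inj p (f a) (f b) (g c)) // es.
- by rewrite block_mxEur Fl Fr es.
- by rewrite block_mxEdl Fl Fr mxE -es signed_invol_sym.
- rewrite block_mxEdr mxE !Fr; have [c [sc _]] := col_s a.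
  apply: contraTeq (fg c b) => pab; rewrite -leqNgt.
  by rewrite (@signed_invol_row_inj p (g a) (g b) (f c)) // signed_invol_sym // es.
Qed.

(** Every row and column of [s] has a nonzero entry, so an occurrence above the
    diagonal can only use opener rows and closer columns. *)
Lemma contains_corner k p (s : 'M[int]_k) : signed_invol p -> signed_perm s ->
  contains_above p s <->
  shape_contains (@arc_shape (openers p) (closers p))
    (corner (openers p) (closers p) p) s.
Proof.
move=> hp [_ row_s col_s]; split=> [[f [g [incf incg fg e]]]|[f [g [incf incg fg e]]]].
  have es a b : p (f a) (g b) = s a b by rewrite -e mxE.
  have /choice[f' ef] a : exists x : 'I_#|openers p|, f a = enum_val x.
    have [b [sab _]] := row_s a; apply: enum_val_onto.
    by apply: (arc_opener (fg a b)); rewrite es.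
  have /choice[g' eg] b : exists x : 'I_#|closers p|, g b = enum_val x.
    have [a [sab _]] := col_s b; apply: enum_val_onto.
    by apply: (arc_closer hp (fg a b)); rewrite es.
  exists f', g'; split.
  - by move=> a b /incf; rewrite !ef enum_val_mono.
  - by move=> a b /incg; rewrite !eg enum_val_mono.
  - by move=> a b; rewrite /arc_shape -ef -eg.
  - by apply/matrixP => a b; rewrite !mxE -ef -eg es.
exists (enum_val \o f), (enum_val \o g); split=> //.
- by move=> a b /incf/enum_val_homo.
- by move=> a b /incg/enum_val_homo.
- by rewrite -e; apply/matrixP => a b; rewrite !mxE.
Qed.

End Matching.

Lemma corner_bij n k (s : 'M[int]_k) (p0 : 'M[int]_n) :
  signed_perm s -> signed_invol p0 ->
  set_bij (fun p => signed_invol_avoiding (double_mx s) p /\ shadow p = shadow p0)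
    (transversal_avoiding (@arc_shape n (openers p0) (closers p0)) s)
    (corner (openers p0) (closers p0)).
Proof.
move=> hs hp0.
have avoids p : signed_invol p -> shadow p = shadow p0 ->
    contains p (double_mx s) <->
    shape_contains (@arc_shape n (openers p0) (closers p0))
      (corner (openers p0) (closers p0) p) s.
  move=> hp [_ <- <-].
  exact: iff_trans (contains_double hp hs) (contains_corner hp hs).
split.
- move=> p [[hp av] e]; split; last by move/(avoids p hp e).
  by case: e => _ <- <-; apply: corner_transversal.
- move=> p q /set_mem[[hp _] ep] /set_mem[[hq _] eq_].
  have [_ eO eC] := ep; rewrite -eO -eC; apply: corner_inj => //.
  by rewrite ep.
- move=> t [ht av]; have hq := assemble_invol hp0 ht.
  have eq_ := shadow_assemble hp0 ht.
  exists (assemble p0 t); last exact: corner_assemble.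
  split=> //; split=> //; move/(avoids _ hq eq_).
  by rewrite corner_assemble.
Qed.

(** * Gluing bijections along a common invariant *)

Lemma set_bij_card_eq (T U : Type) (A : set T) (B : set U) (f : T -> U) :
  set_bij A B f -> A #= B.
Proof. by move=> /Pbij[g _]; apply/card_eqP; squash (sigLR g). Qed.

(** The point [u0] only serves as a value of the function outside [A]. *)
Lemma card_eq_set_bij (T U : Type) (u0 : U) (A : set T) (B : set U) :
  A #= B -> exists f : T -> U, set_bij A B f.
Proof. by move=> /card_eqP[f]; exists (valLR u0 f); apply: bij. Qed.

(** Bijections between corresponding fibres of [c] and [d] are chosen and applied
    fibrewise. *)
Lemma glue_bij (T U I : Type) (u0 : U) (c : T -> I) (d : U -> I)
    (A : set T) (B : set U) :
  (forall i, (fun x => A x /\ c x = i) #= (fun y => B y /\ d y = i)) ->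
  exists f : T -> U, set_bij A B f /\ forall x, A x -> d (f x) = c x.
Proof.
move=> cAB.
have /choice[F FP] i : exists f : T -> U,
    set_bij (fun x => A x /\ c x = i) (fun y => B y /\ d y = i) f.
  exact: card_eq_set_bij u0 _ _ (cAB i).
exists (fun x => F (c x) x).
have cl x : A x -> B (F (c x) x) /\ d (F (c x) x) = c x.
  by move=> Ax; have [+ _ _] := FP (c x); apply.
split=> [|x /cl[]//]; split.
- by move=> x /cl[].
- move=> x y /set_mem Ax /set_mem Ay e.
  have ec : c x = c y by rewrite -(cl x Ax).2 -(cl y Ay).2 e.
  have [_ inj _] := FP (c x); apply: inj; rewrite ?inE //; last by rewrite e ec.
- move=> y By; have [_ _ surj] := FP (d y).
  by have [x [Ax ex] <-] := surj y (conj By erefl); exists x; rewrite ?ex.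
Qed.

Theorem theorem2p2 (k l : nat) (sigma : 'M[int]_k) (tau : 'M[int]_l)
    (hsigma : signed_perm sigma) (htau : signed_perm tau)
    (hequiv : NE_shape_Wilf_equiv sigma tau) :
  I_Wilf_equiv (double_mx sigma) (double_mx tau) /\
  forall n : nat, (0 < n)%N ->
    exists f : 'M[int]_n -> 'M[int]_n,
      set_bij (@signed_invol_avoiding n _ (double_mx sigma))
              (@signed_invol_avoiding n _ (double_mx tau)) f /\
      forall p : 'M[int]_n,
        signed_invol_avoiding (double_mx sigma) p ->
        forall i : 'I_n, fixed_point (f p) i <-> fixed_point p i.
Proof.
suff bij n : exists f : 'M[int]_n -> 'M[int]_n,
    set_bij (@signed_invol_avoiding n _ (double_mx sigma))
            (@signed_invol_avoiding n _ (double_mx tau)) f /\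
    forall p, signed_invol_avoiding (double_mx sigma) p -> shadow (f p) = shadow p.
  split=> n _; have [f [bij_f keep_f]] := bij n; first exact: set_bij_card_eq bij_f.
  exists f; split=> // p hp i; have [f_in _ _] := bij_f.
  rewrite !fixed_point_diag ?(shadow_diag i (keep_f p hp)) //; first by case: hp.
  by case: (f_in p hp).
(* Compare the involutions of one shadow [c] through the transversals of the
   shape of [c]; if no involution has shadow [c], both fibres are empty. *)
apply: (glue_bij 0) => c.
have [[p0 [hp0 <-]]|none] :=
  pselect (exists p0 : 'M[int]_n, signed_invol p0 /\ shadow p0 = c).
  apply: card_eq_trans (set_bij_card_eq (corner_bij hsigma hp0)) _.
  apply: card_eq_trans (hequiv _ _ _ (arc_shape_NE _ _)) _.
  by rewrite card_eq_sym; apply: set_bij_card_eq (corner_bij htau hp0).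
have empty k' (s : 'M[int]_k') :
    (fun p => @signed_invol_avoiding n _ s p /\ shadow p = c) = set0.
  by apply/seteqP; split=> // p [[hp _] e]; apply: none; exists p.
by rewrite !empty.
Qed.
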